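(* Let $F$ be a free group and let $m,n\ge 2$ be natural numbers. Let $N$ be a natural number such that $1\le N-1\le (m-1)(n-1)$. Then there exist subgroups $H,K\le F$, of ranks $m$ and $n$, such that the rank of $H\cap K$ is $N$.
   Context: The rank of a free group is the cardinality of a free basis; subgroups of free groups are free, so $H$, $K$ and $H\cap K$ are free groups.
   Formalization: The free group F is assumed to be non-abelian; for F trivial or infinite cyclic every subgroup has rank at most 1, so no subgroups of ranks m, n ≥ 2 exist and the claim fails. *)

(* Defs.v *)
From mathcomp Require Import all_boot.
From mathcomp Require Import boolp classical_sets functions cardinality.

Set Implicit Arguments.
Unset Strict Implicit.
Unset Printing Implicit Defensive.

Local Open Scope classical_set_scope.
Local Open Scope card_scope.
Local Open Scope group_scope.

Definition is_subgroup (F : groupType) (H : set F) : Prop :=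
  group_closed [in H].

(* A word is a sequence of letters (x, e); the letter (x, false) stands for x
   and (x, true) stands for x^-1. *)
Definition letter_val (F : groupType) (l : F * bool) : F :=
  if l.2 then l.1^-1 else l.1.

Definition word_val (F : groupType) (w : seq (F * bool)) : F :=
  \prod_(l <- w) letter_val l.

(* No letter is immediately followed by its formal inverse. *)
Definition reduced (F : groupType) (w : seq (F * bool)) : bool :=
  sorted (fun l l' => `[< l.1 = l'.1 >] ==> (l.2 == l'.2)) w.

Definition word_over (F : groupType) (B : set F) (w : seq (F * bool)) : bool :=
  all (fun l => l.1 \in B) w.

(* B is a free basis of the subgroup H: every element of H is the product of
   exactly one reduced word in the letters B and their formal inverses.
   Only meant for H a subgroup. *)
Definition is_free_basis (F : groupType) (H B : set F) : Prop :=
  B `<=` H /\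
  forall h, H h ->
    exists! w, word_over B w /\ reduced w /\ word_val w = h.

Definition is_free_group (F : groupType) : Prop :=
  exists B : set F, is_free_basis [set: F] B.

(* The subgroup H is free of rank n. *)
Definition has_rank (F : groupType) (H : set F) (n : nat) : Prop :=
  exists B : set F, is_free_basis H B /\ B #= `I_n.

(* Main.v *)
Require Import Defs.
From mathcomp Require Import all_boot.
From mathcomp Require Import boolp classical_sets functions cardinality.
From mathcomp Require Import ssralg ssrnum ssrint intdiv zify.

Set Implicit Arguments.
Unset Strict Implicit.
Unset Printing Implicit Defensive.

Local Open Scope group_scope.

(** Let a, b be two letters of a free basis and B_x = a^x b a^-x. The family (B_x),
    x an integer, is free and is permuted by conjugation by a. Put p = m - 1,
    q = n - 1, M = N - 1, k = 2q, l = pk + 1. Take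
      K = <a^k, B_i (i < q)>,   H = <a^l, y_j (j < p)>,
    where y_j = B_(kj) if d_j = 0, y_j = [B_(kj), B_(kj + d_j)] otherwise
    ([u, v] = u v u^-1 v^-1), and d_j = q - r_j with 0 <= r_j <= q and sum_j r_j = M.
    Each of these groups is <a^L> extended by the free group on the conjugates of the
    other generators by powers of a^L.

    If g = h a^e lies in both H and K, where h is a product of B's, then kl divides e.
    The endomorphism of <B_x> killing B_x for x mod k >= q fixes h, because g is in K,
    and it either fixes or kills each conjugate of y_j by a power of a^l. Since
    l = 1 mod k, the conjugate by a^(lt) is fixed exactly when t mod k < r_j. Hence
    H and K meet in <a^(kl), a^(li) y_j a^(-li) (i < r_j)>, which has rank 1 + M. *)

(** * Integer powers in a group *)

Section IntegerPowers.
Variable G : groupType.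
Implicit Types (x : G) (m n : int).

Definition expz x n : G := match n with Posz k => x ^+ k | Negz k => x ^- k.+1 end.

Lemma expz0 x : expz x 0 = 1.
Proof. exact: expg0. Qed.

Lemma expzSr x n : expz x (n + 1)%R = expz x n * x.
Proof.
case: n => k; first by rewrite (_ : (_ + 1)%R = Posz k.+1) /= ?expgSr //; lia.
case: k => [|k].
  by rewrite (_ : (_ + 1)%R = 0%R) /= ?expg0 ?expg1 ?mulVg.
rewrite (_ : (_ + 1)%R = Negz k) /=; last by lia.
by rewrite (expgS x k.+1) invgM mulgVK.
Qed.

Lemma expz_pred x n : expz x (n - 1)%R = expz x n * x^-1.
Proof. by rewrite -{2}(GRing.subrK 1%R n) expzSr mulgK. Qed.

Lemma expzD x m n : expz x (m + n)%R = expz x m * expz x n.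
Proof.
elim: n => [|n IH|n IH]; first by rewrite GRing.addr0 expz0 mulg1.
  have -> : (Posz n.+1 = n%:Z + 1)%R by lia.
  by rewrite GRing.addrA !expzSr IH mulgA.
have -> : (- Posz n.+1 = - n%:Z - 1)%R by lia.
by rewrite GRing.addrA !expz_pred IH mulgA.
Qed.

Lemma expzN x n : expz x (- n)%R = (expz x n)^-1.
Proof. by apply/esym/mulg1_eq; rewrite -expzD GRing.subrr expz0. Qed.

Lemma expzM x m n : expz x (m * n)%R = expz (expz x m) n.
Proof.
elim: n => [|n IH|n IH]; first by rewrite GRing.mulr0 !expz0.
  have -> : (Posz n.+1 = n%:Z + 1)%R by lia.
  by rewrite expzSr GRing.mulrDr GRing.mulr1 expzD IH.
have -> : (- Posz n.+1 = - n%:Z - 1)%R by lia.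
by rewrite expz_pred -IH GRing.mulrDr GRing.mulrN1 expzD (expzN x m).
Qed.

End IntegerPowers.

(** * Reduced words over an index type and their values *)

Section Words.
Variable I : eqType.
Implicit Types (l : I * bool) (w : seq (I * bool)).

Definition inv_letter l := (l.1, ~~ l.2).

Definition inv_word w := rev (map inv_letter w).

Definition noncancelling l l' := l' != inv_letter l.

Definition is_reduced w := sorted noncancelling w.

Definition push l w :=
  if w is l' :: w' then if l' == inv_letter l then w' else l :: w else [:: l].

Definition reduce w := foldr push [::] w.

Lemma inv_letterK : involutive inv_letter.
Proof. by case=> i e; rewrite /inv_letter /= negbK. Qed.

Lemma inv_word_cat w w' : inv_word (w ++ w') = inv_word w' ++ inv_word w.
Proof. by rewrite /inv_word map_cat rev_cat. Qed.

Lemma mem_inv_word l w : (l \in inv_word w) = (inv_letter l \in w).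
Proof.
by rewrite mem_rev -{1}(inv_letterK l) mem_map //; apply/inv_inj/inv_letterK.
Qed.

Lemma inv_word_nilP w : (inv_word w == [::]) = (w == [::]).
Proof. by rewrite -!size_eq0 size_rev size_map. Qed.

Lemma is_reduced_inv w : is_reduced (inv_word w) = is_reduced w.
Proof.
rewrite /is_reduced rev_sorted sorted_map; apply: eq_sorted => l l'.
rewrite /= /noncancelling inv_letterK; congr (~~ _).
by rewrite [LHS]eq_sym -(inj_eq (inv_inj inv_letterK)) inv_letterK.
Qed.

Lemma reduce_is_reduced w : is_reduced (reduce w).
Proof.
elim: w => //= l w; case: (reduce w) => //= l' w' IH.
case: ifP => [_|/negbT ne]; first exact: path_sorted IH.
by rewrite /is_reduced /= IH andbT.
Qed.

Lemma is_reduced_catr w w' : is_reduced (w ++ w') -> is_reduced w'.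
Proof.
by case: w => //= l w; rewrite /is_reduced /= cat_path => /andP[_ /path_sorted].
Qed.

Lemma is_reduced_cat w w' : is_reduced w -> is_reduced w' ->
  (forall l l', l \in w -> l' \in w' -> l.1 <> l'.1) -> is_reduced (w ++ w').
Proof.
case: w => //= l w; case: w' => [|l' w']; first by rewrite cats0.
move=> hw hw' dis; rewrite /is_reduced /= cat_path; apply/andP; split=> //=.
apply/andP; split=> //.
apply/eqP => e; apply: (dis (last l w) l'); rewrite ?mem_last ?mem_head //.
by rewrite e.
Qed.

Definition power_word (i : I) (n : int) := nseq `|n|%N (i, (n < 0)%R).

Lemma path_nseq l k w :
  path noncancelling l (nseq k l ++ w) = path noncancelling l w.
Proof.
have ll : noncancelling l l.
  by case: l => i []; rewrite /noncancelling /inv_letter xpair_eqE andbF.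
by elim: k => //= k ->; rewrite ll.
Qed.

Lemma is_reduced_square l : is_reduced [:: l; l].
Proof.
by case: l => i []; rewrite /is_reduced /= /noncancelling /inv_letter /= xpair_eqE andbF.
Qed.

(** Reducedness constrains adjacent letters only, and a nonempty [v] keeps [u] and [w] apart. *)
Lemma is_reduced_overlap u v w : v != [::] ->
  is_reduced (u ++ v) -> is_reduced (v ++ w) -> is_reduced (u ++ v ++ w).
Proof.
case: u => //= x p; case: v => //= y q _.
rewrite /is_reduced /= !cat_path /= !cat_path.
by move=> /andP[-> /andP[-> ->]] /andP[_ ->].
Qed.

Section Evaluation.
Variables (G : groupType) (f : I -> G).

(** Letters carry indices rather than group elements, so that one word can be evaluated under
    several maps [f]. *)
Definition eval w : G := \prod_(l <- w) letter_val (f l.1, l.2).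

Lemma eval_nil : eval [::] = 1.
Proof. exact: big_nil. Qed.

Lemma eval_cons l w : eval (l :: w) = letter_val (f l.1, l.2) * eval w.
Proof. exact: big_cons. Qed.

Lemma eval_cat w w' : eval (w ++ w') = eval w * eval w'.
Proof. exact: big_cat. Qed.

Lemma eval1 i : eval [:: (i, false)] = f i.
Proof. by rewrite eval_cons eval_nil mulg1. Qed.

Lemma letter_val_inv l :
  letter_val (f (inv_letter l).1, (inv_letter l).2) = (letter_val (f l.1, l.2))^-1.
Proof. by case: l => i []; rewrite /letter_val //= invgK. Qed.

Lemma eval_inv w : eval (inv_word w) = (eval w)^-1.
Proof.
elim: w => [|l w IH]; first by rewrite eval_nil invg1.
rewrite -cat1s inv_word_cat !eval_cat IH invgM; congr (_ * _).
by rewrite !eval_cons letter_val_inv !eval_nil !mulg1.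
Qed.

Lemma eval_reduce w : eval (reduce w) = eval w.
Proof.
elim: w => //= l w IH; rewrite eval_cons -IH.
case: (reduce w) => [|l' w'] /=; first by rewrite eval_cons.
case: eqP => [->|_]; last by rewrite eval_cons.
by rewrite eval_cons letter_val_inv mulgA mulgV mul1g.
Qed.

Lemma eval_power_word i n : eval (power_word i n) = expz (f i) n.
Proof.
have aux l k : eval (nseq k l) = letter_val (f l.1, l.2) ^+ k.
  by elim: k => [|k IH] /=; rewrite ?eval_nil ?expg0 // eval_cons IH expgS.
rewrite /power_word aux; case: n => k /=; first by rewrite /letter_val /=.
by rewrite /letter_val /= -expVgn.
Qed.

End Evaluation.

Lemma eq_eval (G : groupType) (f g : I -> G) : f =1 g -> eval f =1 eval g.
Proof. by move=> fg w; apply: eq_bigr => l _; rewrite fg. Qed.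

End Words.

(** * Free families, alone and relative to the powers of an element *)

Section FreeFamilies.
Variable G : groupType.

Definition free_family (I : eqType) (f : I -> G) :=
  forall w, is_reduced w -> eval f w = 1 -> w = [::].

(* Recording the exponent of a next to the reduced word replaces a homomorphism
   from the group to the integers. *)
Definition free_rel (a : G) (I : eqType) (f : I -> G) :=
  forall w n, is_reduced w -> eval f w * expz a n = 1 -> w = [::] /\ n = 0%R.

Lemma eq_free_rel a (I : eqType) (f g : I -> G) :
  f =1 g -> free_rel a f -> free_rel a g.
Proof. by move=> fg hf w n hw; rewrite -(eq_eval fg); apply: hf. Qed.

(** The quotient of the two words reduces to the empty word, so they agree under every [g]. This
    replaces extending [g] to a homomorphism. *)
Lemma free_rel_eq a (I : eqType) (f : I -> G) w w' n n' : free_rel a f ->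
  eval f w * expz a n = eval f w' * expz a n' ->
  n = n' /\ forall g : I -> G, eval g w = eval g w'.
Proof.
move=> hf e.
have /(hf _ _ (reduce_is_reduced _))[r0 n0] :
    eval f (reduce (inv_word w' ++ w)) * expz a (n - n')%R = 1.
  rewrite eval_reduce eval_cat eval_inv expzD expzN mulgA -(mulgA _ (eval f w)) e.
  by rewrite mulKg mulgV.
split=> [|g]; first by lia.
have e0 : (eval g w')^-1 * eval g w = 1.
  by rewrite -eval_inv -eval_cat -eval_reduce r0 eval_nil.
by rewrite -(mulg1_eq e0) invgK.
Qed.

End FreeFamilies.

(** * Freeness of the conjugates of b by powers of a *)

Definition conjz (G : groupType) (a x : G) (n : int) := expz a n * x * expz a (- n)%R.

Section Conjugates.
Variables (G : groupType) (a b : G).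

(** Adjacent factors a^(-h) and a^x of neighbouring conjugates are merged into a^(x-h); [h] is the
    exponent left open so far and [n] the final power of a. *)
Fixpoint expand (h : int) (w : seq (int * bool)) (n : int) : seq (bool * bool) :=
  match w with
  | [::] => power_word false (n - h)%R
  | (x, e) :: w' => power_word false (x - h)%R ++ (true, e) :: expand x w' n
  end.

Lemma eval_expand h w n :
  eval (fun c : bool => if c then b else a) (expand h w n) =
  expz a (- h)%R * eval (conjz a b) w * expz a n.
Proof.
elim: w h => [|[x e] w IH] h /=.
  by rewrite eval_power_word eval_nil mulg1 -expzD GRing.addrC.
rewrite eval_cat !eval_cons IH eval_power_word /= GRing.addrC expzD -!mulgA.
congr (_ * _); rewrite !mulgA; congr (_ * _ * _).
by case: e; rewrite /conjz /letter_val /= ?invgM !expzN ?invgK ?mulgA.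
Qed.

(** Two letters b meet only when the power of a between them is trivial, and then equal signs
    exclude cancellation. *)
Lemma path_power_word e z e' (w : seq (bool * bool)) :
  (z = 0%R -> e = e') -> path (@noncancelling _) (true, e') w ->
  path (@noncancelling _) (true, e) (power_word false z ++ (true, e') :: w).
Proof.
rewrite /power_word; case: z => [[|k]|k] /= he hw.
- by rewrite hw he // andbT; case: (e').
- by rewrite path_nseq /= hw.
- by rewrite path_nseq /= hw.
Qed.

Lemma path_expand x e w n :
  path (@noncancelling _) (x, e) w -> path (@noncancelling _) (true, e) (expand x w n).
Proof.
elim: w x e => [|[y e'] w IH] x e /=.
  rewrite /power_word => _; case: `|_|%N => //= k.
  by rewrite -[nseq _ _]cats0 path_nseq.
case/andP=> nc /IH hw; apply: path_power_word => // yx.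
have {}yx : y = x by lia.
by move: nc; rewrite /noncancelling /inv_letter /= yx xpair_eqE eqxx; case: e e' {IH hw} => -[].
Qed.

(** The expansion is a reduced word in a and b of value 1, hence empty; a nonempty [w] would leave a
    letter b in it. *)
Lemma free_rel_conjz :
  free_family (fun c : bool => if c then b else a) -> free_rel a (conjz a b).
Proof.
move=> hf w n hw e1; have : expand 0 w n = [::].
  apply: hf; last by rewrite eval_expand -mulgA e1 mulg1 expz0.
  case: w hw {e1} => [_|[x e] w] /=.
    by rewrite /is_reduced /power_word; case: `|_|%N => //= k; rewrite -[nseq _ _]cats0 path_nseq.
  move=> /(path_expand n) hw; apply: (@path_sorted _ _ (true, e)).
  exact: path_power_word.
case: w {hw e1} => [|[x e] w] /=; last by case: (power_word _ _).
by rewrite /power_word; case E: (`|_|%N) => // _; split=> //; lia.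
Qed.

End Conjugates.

(** * Substituting words for letters *)

Section Substitution.
Variables (I J : eqType) (s : J -> seq (I * bool)).

Definition subst_letter (l : J * bool) := if l.2 then inv_word (s l.1) else s l.1.

Definition subst_word w := flatten (map subst_letter w).

Lemma eval_subst (G : groupType) (f : I -> G) w :
  eval f (subst_word w) = eval (fun j => eval f (s j)) w.
Proof.
elim: w => [|[j e] w IH]; first by rewrite !eval_nil.
by rewrite /= eval_cat eval_cons -IH; case: e; rewrite /subst_letter /= ?eval_inv.
Qed.

Hypothesis s_nil : forall j, s j != [::].
Hypothesis s_reduced : forall j, is_reduced (s j ++ s j).
Hypothesis s_disjoint : forall j j' l l',
  l \in s j -> l' \in s j' -> l.1 = l'.1 -> j = j'.

Lemma subst_letter_nil l : subst_letter l != [::].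
Proof. by rewrite /subst_letter; case: l.2; rewrite ?inv_word_nilP. Qed.

Lemma mem_subst_letter l x :
  x \in subst_letter l -> exists2 y, y \in s l.1 & y.1 = x.1.
Proof.
rewrite /subst_letter; case: l.2; last by exists x.
by rewrite mem_inv_word; exists (inv_letter x).
Qed.

(** Different indices give disjoint supports; equal indices force equal signs, and then cyclic
    reducedness of [s j] applies. *)
Lemma subst_letters_reduced l l' :
  noncancelling l l' -> is_reduced (subst_letter l ++ subst_letter l').
Proof.
move=> nc; have red l0 : is_reduced (subst_letter l0).
  rewrite /subst_letter; case: l0.2; rewrite ?is_reduced_inv;
  exact: is_reduced_catr (s_reduced _).
have [e1|ne] := eqVneq l.1 l'.1; last first.
  apply: is_reduced_cat => // x x' /mem_subst_letter[y ys <-].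
  by case/mem_subst_letter=> y' ys' <- /s_disjoint h; case/eqP: ne; apply: h.
have e2 : l.2 = l'.2.
  move: l l' nc e1 => [j e] [j' e'] /=; rewrite /noncancelling /inv_letter /= => + jj.
  by rewrite jj xpair_eqE eqxx; case: e e' => -[].
rewrite /subst_letter -e1 -e2; case: l.2; last exact: s_reduced.
by rewrite -inv_word_cat is_reduced_inv.
Qed.

Lemma subst_word_reduced w : is_reduced w -> is_reduced (subst_word w).
Proof.
elim: w => [|l [|l' w] IH] //.
  move=> _; rewrite /subst_word /= cats0 /subst_letter.
  by case: l.2; rewrite ?is_reduced_inv; exact: is_reduced_catr (s_reduced _).
case/andP=> nc hw; apply: is_reduced_overlap; first exact: subst_letter_nil.
  exact: subst_letters_reduced.
exact: IH.
Qed.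

Lemma free_rel_subst (G : groupType) (a : G) (f : I -> G) :
  free_rel a f -> free_rel a (fun j => eval f (s j)).
Proof.
move=> hf w n /subst_word_reduced hw; rewrite -eval_subst => /(hf _ _ hw)[w0 ->].
split=> //; case: w w0 {hw} => //= l w.
by have := subst_letter_nil l; rewrite /subst_word /=; case: (subst_letter l).
Qed.

End Substitution.

(** * Subgroups and generation *)

Definition generated (G : groupType) (I : eqType) (f : I -> G) : set G :=
  [set g | exists w, g = eval f w]%classic.

Section Subgroups.
Variable G : groupType.
Implicit Types (H : set G).

Lemma is_subgroupP H : is_subgroup H <->
  H 1 /\ forall x y, H x -> H y -> H (x / y).
Proof.
split=> [[h1 hd]|[h1 hd]]; split.
- by move: h1; rewrite inE.
- by move=> x y hx hy; have := hd x y; rewrite !inE; apply.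
- by rewrite inE.
- by move=> x y; rewrite !inE; apply: hd.
Qed.

Lemma subgroupV H x : is_subgroup H -> H x -> H x^-1.
Proof. by case/is_subgroupP=> h1 hd /(hd _ _ h1); rewrite mul1g. Qed.

Lemma subgroupM H x y : is_subgroup H -> H x -> H y -> H (x * y).
Proof.
move=> hH hx /(subgroupV hH) hy; case/is_subgroupP: hH => _ hd.
by rewrite -(invgK y); apply: hd.
Qed.

Lemma subgroup_eval H (I : eqType) (f : I -> G) w : is_subgroup H ->
  (forall l, l \in w -> H (f l.1)) -> H (eval f w).
Proof.
move=> hH; elim: w => [|[i e] w IH] hf.
  by rewrite eval_nil; case/is_subgroupP: hH.
rewrite eval_cons; apply: subgroupM => //; last first.
  by apply: IH => l lw; apply: hf; rewrite inE lw orbT.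
have hi : H (f i) by apply: (hf (i, e)); rewrite mem_head.
by case: e {hf}; rewrite /letter_val //=; apply: subgroupV.
Qed.

Lemma subgroup_expz H x n : is_subgroup H -> H x -> H (expz x n).
Proof.
move=> hH hx; rewrite -[x]/((fun=> x) tt) -eval_power_word.
exact: subgroup_eval.
Qed.

Lemma generated_subgroup (I : eqType) (f : I -> G) : is_subgroup (generated f).
Proof.
apply/is_subgroupP; split; first by exists [::]; rewrite eval_nil.
by move=> _ _ [w ->] [w' ->]; exists (w ++ inv_word w'); rewrite eval_cat eval_inv.
Qed.

Lemma generated_id (I : eqType) (f : I -> G) i : generated f (f i).
Proof. by exists [:: (i, false)]; rewrite eval1. Qed.

End Subgroups.

(** * Adjoining a power of a to a family of generators *)

Section CyclicExtension.
Variables (G : groupType) (a : G) (L : int) (J : eqType) (y : J -> G).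
Hypothesis L_neq0 : L != 0%R.

Definition adjoin_power : option J -> G := oapp y (expz a L).

Definition conj_family (tj : int * J) : G := conjz a (y tj.2) (L * tj.1)%R.

Definition step (e : bool) : int := if e then (-1)%R else 1%R.

(** Reidemeister-Schreier rewriting: powers of a^L are pushed to the right past the other
    generators, [t] being the exponent accumulated so far. *)
Fixpoint collect (t : int) (w : seq (option J * bool)) : seq (int * J * bool) :=
  match w with
  | [::] => [::]
  | (Some j, e) :: w' => ((t, j), e) :: collect t w'
  | (None, e) :: w' => collect (t + step e)%R w'
  end.

Fixpoint height (t : int) (w : seq (option J * bool)) : int :=
  match w with
  | [::] => t
  | (Some _, _) :: w' => height t w'
  | (None, e) :: w' => height (t + step e)%R w'
  end.

Lemma eval_collect t w : expz a (L * t)%R * eval adjoin_power w =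
  eval conj_family (collect t w) * expz a (L * height t w)%R.
Proof.
elim: w t => [|[[j|] e] w IH] t /=; first by rewrite !eval_nil mulg1 mul1g.
  rewrite !eval_cons -mulgA -IH mulgA; rewrite !mulgA; congr (_ * _).
  by case: e; rewrite /letter_val /conj_family /conjz /= ?invgM !expzN ?invgK ?mulgA mulgVK.
rewrite -IH eval_cons mulgA; congr (_ * _).
rewrite GRing.mulrDr expzD; congr (_ * _).
by case: e; rewrite /letter_val /= ?GRing.mulrN1 ?GRing.mulr1 ?expzN.
Qed.

(** [t'] lies strictly beyond [t] in the direction in which a power letter of sign [e] moves the
    height. *)
Definition before (e : bool) (t t' : int) := if e then (t' < t)%R else (t < t')%R.

(** Consecutive generators stay noncancelling. After a run of power letters, all of one sign by
    reducedness, the height has left [t0] for good, so the next collected letter has another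
    index. *)
Lemma collect_reduced_aux w :
  (forall t j e, path (@noncancelling _) (Some j, e) w ->
    path (@noncancelling _) ((t, j), e) (collect t w)) /\
  (forall t t0 j e0 e, path (@noncancelling _) (None, e) w -> before e t0 t ->
    path (@noncancelling _) ((t0, j), e0) (collect t w)).
Proof.
elim: w => [|[o e'] w [IHs IHn]] //; split=> [t j e|t t0 j e0 e] /= /andP[nc hw].
  case: o nc hw => [j'|] nc hw /=.
    rewrite IHs // andbT; move: nc; rewrite /noncancelling /inv_letter /=.
    by apply: contraNN => /eqP[-> ->].
  by apply: IHn hw _; case: (e'); rewrite /before /step; lia.
case: o nc hw => [j'|] nc hw /= bf.
  rewrite IHs // andbT /noncancelling /inv_letter /= !xpair_eqE !negb_and.
  by move: bf; rewrite /before; case: (e) => h; apply/orP; left; apply/orP; left; apply/eqP; lia.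
have ee : e' = e by move: nc; rewrite /noncancelling /inv_letter /=; case: (e') (e) => -[].
rewrite ee in hw *; apply: IHn hw _.
by move: bf; case: (e); rewrite /before /step; lia.
Qed.

Lemma collect_reduced t w : is_reduced w -> is_reduced (collect t w).
Proof.
elim: w t => [|[[j|] e] w IH] t //= hw; last exact: IH (path_sorted hw).
by have [h _] := collect_reduced_aux w; apply: h.
Qed.

Lemma height_collect_nil t t0 e w : path (@noncancelling _) (None, e) w ->
  collect t w = [::] -> before e t0 t -> before e t0 (height t w).
Proof.
elim: w t => [|[[j|] e'] w IH] t //= /andP[nc hw] hc bf.
have ee : e' = e by move: nc; rewrite /noncancelling /inv_letter /=; case: (e') (e) => -[].
rewrite ee in hw hc *; apply: IH => //.
by move: bf; case: (e); rewrite /before /step; lia.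
Qed.

(** A word of value 1 collects to the empty word and, as [L] is nonzero, has height 0. Were it
    nonempty, it would be a run of power letters of one sign, whose height is not 0. *)
Lemma free_adjoin_power :
  free_rel a conj_family -> free_family adjoin_power.
Proof.
move=> hf w hw e1; have := eval_collect 0 w.
rewrite e1 mulg1 GRing.mulr0 expz0 => /esym /(hf _ _ (collect_reduced 0 hw))[c0].
move/eqP; rewrite GRing.mulf_eq0 (negPf L_neq0) /= => /eqP h0.
case: w hw c0 h0 {e1} => [|[[j|] e] w] //= hw c0 h0.
have := height_collect_nil (t0 := 0%R) hw c0; rewrite h0 => h.
suff : before e 0 0 by case: (e); rewrite /before; lia.
by apply: h; case: (e).
Qed.

Lemma generated_expz n : generated adjoin_power (expz a (L * n)%R).
Proof.
rewrite expzM; apply: subgroup_expz; first exact: generated_subgroup.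
exact: (generated_id adjoin_power None).
Qed.

Lemma generated_conj_family tj : generated adjoin_power (conj_family tj).
Proof.
have hs := generated_subgroup adjoin_power.
rewrite /conj_family /conjz -GRing.mulrN.
apply: subgroupM (generated_expz _) => //; apply: subgroupM (generated_expz _) _ => //.
exact: (generated_id adjoin_power (Some tj.2)).
Qed.

Lemma generated_adjoin_power g : generated adjoin_power g ->
  exists w t, g = eval conj_family w * expz a (L * t)%R.
Proof.
move=> [w ->]; exists (collect 0 w), (height 0 w).
by rewrite -eval_collect GRing.mulr0 expz0 mul1g.
Qed.

End CyclicExtension.

(** * From free families to free bases and rank *)

Section Rank.
Variable G : groupType.

Lemma free_family_inj (I : eqType) (f : I -> G) w w' : free_family f ->
  is_reduced w -> is_reduced w' -> eval f w = eval f w' -> w = w'.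
Proof.
move=> hf; elim: w w' => [|l w IH] [|l' w'] // hw hw' e.
- by rewrite (hf _ hw') // -e eval_nil.
- by rewrite (hf _ hw) // e eval_nil.
have [ll|ne] := eqVneq l l'.
  subst l'; congr (_ :: _); apply: IH; [exact: path_sorted hw|exact: path_sorted hw'|].
  by move: e; rewrite !eval_cons => /mulgI.
(* Since the first letters differ, nothing cancels at the junction: this nonempty word is reduced
   and has value 1. *)
have : inv_word (l :: w) ++ l' :: w' = [::].
  apply: hf; last by rewrite eval_cat eval_inv e mulVg.
  rewrite /inv_word /= rev_cons cat_rcons -cat1s.
  apply: is_reduced_overlap => //.
    by rewrite cats1 -rev_cons -/(inv_word (l :: w)) is_reduced_inv.
  by rewrite /= /is_reduced /= [path _ _ _]hw' andbT /noncancelling inv_letterK eq_sym.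
by rewrite /inv_word /= rev_cons cat_rcons; case: (rev _).
Qed.

Lemma free_family_injective (I : eqType) (f : I -> G) : free_family f -> injective f.
Proof.
move=> hf i j ij; have : [:: (i, false)] = [:: (j, false)].
  by apply: (free_family_inj hf) => //; rewrite !eval1.
by case.
Qed.

Lemma word_val_map (I : eqType) (f : I -> G) w :
  word_val [seq (f l.1, l.2) | l <- w] = eval f w.
Proof. by rewrite /word_val big_map. Qed.

Lemma reduced_map (I : eqType) (f : I -> G) w : injective f ->
  reduced [seq (f l.1, l.2) | l <- w] = is_reduced w.
Proof.
move=> inj; rewrite /reduced sorted_map; apply: eq_sorted => -[i e] [j e'] /=.
rewrite /noncancelling /inv_letter /= xpair_eqE negb_and.
have -> : `[< f i = f j >] = (j == i).
  by apply/asboolP/eqP => [/inj ->|->].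
by case: (j == i) e e' => -[] [].
Qed.

Lemma free_family_basis (I : eqType) (f : I -> G) : free_family f ->
  is_free_basis (generated f) (range f).
Proof.
move=> hf; have inj := free_family_injective hf.
split=> [_ [i _ <-]|h [w hw]]; first exact: generated_id.
exists [seq (f l.1, l.2) | l <- reduce w]; split.
  split; last by rewrite reduced_map // reduce_is_reduced word_val_map eval_reduce.
  by apply/allP => _ /mapP[l _ ->] /=; rewrite inE; exists l.1.
move=> u [uf [ur uv]].
have [v vu] : exists v, u = [seq (f l.1, l.2) | l <- v].
  elim: u uf {ur uv} => [|[x e] u IH]; first by exists [::].
  by case/andP=> /set_mem[i _ /= <-] /IH[v ->]; exists ((i, e) :: v).
move: ur uv; rewrite vu reduced_map // word_val_map => vr vv; congr (map _ _).
by apply: (free_family_inj hf) => //; rewrite ?reduce_is_reduced // eval_reduce vv.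
Qed.

Lemma free_family_has_rank (I : finType) (f : I -> G) : free_family f ->
  has_rank (generated f) #|I|.
Proof.
move=> hf; exists (range f); split; first exact: free_family_basis.
have -> : range f = range (fun i : 'I_#|I| => f (enum_val i)).
  apply/seteqP; split=> _ [i _ <-]; last by exists (enum_val i).
  by exists (enum_rank i) => //=; rewrite enum_rankK.
apply: card_eq_trans (card_esym card_II); apply: inj_card_eq; apply: in2W.
exact: (inj_comp (free_family_injective hf) (@enum_val_inj _ _)).
Qed.

End Rank.

(** * A free pair in a noncommutative free group *)

Lemma free_group_free_pair (F : groupType) : is_free_group F ->
  ~ (forall x y : F, commute x y) ->
  exists a b : F, free_family (fun c : bool => if c then b else a).
Proof.
move=> [B [_ hB]] hnab.
have [[a [b [Ba [Bb ab]]]]|none] := pselect (exists a b, B a /\ B b /\ a <> b).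
  exists a, b => w hw e1; set f := fun c : bool => _ in e1.
  have inj : injective f by move=> [] [] //= ba; case: ab.
  have [w1 [_ uniq]] := hB 1 I.
  have w10 : w1 = [::] by apply: uniq; rewrite /word_val big_nil.
  have : w1 = [seq (f l.1, l.2) | l <- w].
    apply: uniq; rewrite reduced_map // word_val_map; do !split=> //.
    by apply/allP => _ /mapP[[c e] _ ->] /=; rewrite inE; case: c.
  by rewrite w10; case: (w).
(* With at most one basis element, all letters are that element or its inverse, so all products
   commute. *)
case: hnab => x y.
have eqB u v : B u -> B v -> u = v.
  by move=> hu hv; apply: contrapT => uv; apply: none; exists u, v.
have pow z : exists w, all (fun l => l.1 \in B) w /\ word_val w = z.
  by have [w [[h1 [_ h2]] _]] := hB z I; exists w.
have [w [+ <-]] := pow x; have [w' [+ <-]] := pow y.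
move=> /allP hw' /allP hw; rewrite /word_val.
rewrite big_seq [X in commute _ X]big_seq.
apply: commute_prod => l' lw'; apply: commute_sym; apply: commute_prod => l lw.
have -> : l = (l'.1, l.2).
  by case: l lw => u e /hw /set_mem /= hu; rewrite (eqB _ _ hu (set_mem (hw' _ lw'))).
have c1 : commute l'.1 l'.1 by [].
rewrite /letter_val /=; case: (l.2) (l'.2) => -[] //.
- exact: commuteV.
- by apply: commute_sym; apply: commuteV.
Qed.

(** * Conjugation identities and arithmetic *)

Lemma conjzD (G : groupType) (a x : G) m n :
  conjz a (conjz a x m) n = conjz a x (m + n)%R.
Proof.
by rewrite /conjz GRing.opprD GRing.addrC !expzD !mulgA -(mulgA _ (expz a (- m)%R)) -!expzD
  [(- m + - n)%R]GRing.addrC.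
Qed.

Lemma eval_conjz (G : groupType) (I : eqType) (a : G) (f : I -> G) w n :
  eval (fun i => conjz a (f i) n) w = conjz a (eval f w) n.
Proof.
elim: w => [|[i e] w IH]; first by rewrite !eval_nil /conjz mulg1 expzN mulgV.
rewrite !eval_cons IH /conjz expzN; case: e; rewrite /letter_val /= ?invgM ?invgK !gnorm //.
Qed.

Lemma euclid_unique (L t t' u u' : int) : (0 <= u < L)%R -> (0 <= u' < L)%R ->
  (L * t + u = L * t' + u')%R -> t = t' /\ u = u'.
Proof.
move=> hu hu' e; have tt' : t = t' by nia.
by split=> //; move: e; rewrite tt' => /GRing.addrI.
Qed.

Lemma sum_minn_chunks p q M : M <= p * q ->
  \sum_(j < p) minn q (M - q * j) = M.
Proof.
(* The bound on [M] does not survive induction on [p]; the truncated sum does. *)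
move=> hM; suff -> : \sum_(j < p) minn q (M - q * j) = minn M (p * q) by lia.
elim: p {hM} => [|p IH]; first by rewrite big_ord0; lia.
by rewrite big_ord_recr /= IH; nia.
Qed.

(** * The two subgroups and the free families behind them *)

Section Construction.
Variables (G : groupType) (a b : G) (p q M : nat).
Hypothesis ab_free : free_family (fun c : bool => if c then b else a).
Hypotheses (q_gt0 : 0 < q) (M_le : M <= p * q).

(** The factor 2 keeps [i + d j] below [k] whenever [i < q], so shifting by [d j] never wraps around
    modulo [k]. *)
Let k := (2 * q)%N.
Let l := (p * k + 1)%N.

(** Greedy splitting of [M] into [p] chunks of size at most [q]. *)
Let r (j : nat) := minn q (M - q * j).

Let d (j : nat) := q - r j.

Let B := conjz a b.

(* With a commutator, killing some of the letters either fixes or kills the value of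
   the block; a product of two letters could be sent to a single letter. *)
Definition block (x : int) (e : nat) : seq (int * bool) :=
  if e == 0 then [:: (x, false)] else
  [:: (x, false); ((x + e%:Z)%R, false); (x, true); ((x + e%:Z)%R, true)].

Lemma block_neq_nil x e : block x e != [::].
Proof. by rewrite /block; case: ifP. Qed.

Lemma block_reduced x e : is_reduced (block x e ++ block x e).
Proof.
rewrite /block; have [_|e0] := eqVneq e 0.
  by rewrite /is_reduced /= /noncancelling /inv_letter /= xpair_eqE andbF.
rewrite /is_reduced /= /noncancelling /inv_letter /= !xpair_eqE !eqxx /= !andbF /= !andbT.
by have -> : x != (x + e%:Z)%R by apply/eqP; lia.
Qed.

Lemma mem_block x e z : z \in block x e -> z.1 = x \/ z.1 = (x + e%:Z)%R.
Proof.
rewrite /block; case: ifP => _; rewrite !inE; first by move=> /eqP ->; left.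
by case/or4P=> /eqP ->; [left|right|left|right].
Qed.

Lemma eval_block_shift x e n : conjz a (eval B (block x e)) n = eval B (block (x + n)%R e).
Proof.
rewrite -eval_conjz /block; case: ifP => _; rewrite !eval_cons !eval_nil /B !conjzD //=.
by rewrite ![(x + e%:Z + n)%R]GRing.addrAC.
Qed.

Definition gen_left (j : 'I_p) : G := eval B (block (k * j)%N (d j)).
Definition gen_right (i : 'I_q) : G := B (i : nat).

Let cL := conj_family a l gen_left.
Let cR := conj_family a k gen_right.

Definition word_left (tj : int * 'I_p) := block ((k * tj.2)%N%:Z + l%:Z * tj.1)%R (d tj.2).
Definition word_right (ti : int * 'I_q) : seq (int * bool) :=
  [:: (((ti.2 : nat)%:Z + k%:Z * ti.1)%R, false)].

Lemma cL_word : cL =1 fun tj => eval B (word_left tj).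
Proof. by move=> [t j]; rewrite /cL /conj_family /gen_left /= eval_block_shift. Qed.

Lemma cR_word : cR =1 fun ti => eval B (word_right ti).
Proof. by move=> [t i]; rewrite /cR /conj_family /gen_right /= /B conjzD eval1. Qed.

Lemma k_gt0 : 0 < k. Proof. by rewrite /k; lia. Qed.

Lemma d_le j : d j <= q. Proof. by rewrite /d; lia. Qed.

(** Division by [l], then by [k], recovers [t] and [j]. Hence distinct conjugates of the y_j use
    disjoint sets of letters. *)
Lemma left_index_unique (t t' : int) (j j' u u' : nat) :
  j < p -> j' < p -> u <= q -> u' <= q ->
  ((k * j)%N%:Z + l%:Z * t + u%:Z = (k * j')%N%:Z + l%:Z * t' + u'%:Z)%R ->
  t = t' /\ j = j'.
Proof.
move=> jp jp' uq uq' e.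
have bound i v : i < p -> v <= q -> (k * i + v < l)%N by rewrite /l /k; nia.
have b1 := bound _ _ jp uq; have b2 := bound _ _ jp' uq'.
have [|||tt e2] := @euclid_unique l t t' (k * j + u)%N (k * j' + u')%N; try lia.
have [|||e3 _] := @euclid_unique k j j' u u'; try by rewrite /k; lia.
Qed.

Lemma free_cL : free_rel a cL.
Proof.
apply: eq_free_rel (fsym cL_word) _; apply: free_rel_subst (free_rel_conjz ab_free).
- by move=> tj; exact: block_neq_nil.
- by move=> tj; exact: block_reduced.
move=> [t j] [t' j'] x x' /mem_block /= hx /mem_block /= hx' e.
have offset z y e0 : z = y \/ z = (y + e0%:Z)%R -> e0 <= q ->
    exists2 u : nat, u <= q & z = (y + u%:Z)%R.
  by case=> -> hq; [exists 0%N; rewrite ?GRing.addr0 | exists e0].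
have [u uq xE] := offset _ _ _ hx (d_le j).
have [u' uq' xE'] := offset _ _ _ hx' (d_le j').
have [-> jj] := left_index_unique (ltn_ord j) (ltn_ord j') uq uq'
  (etrans (esym xE) (etrans e xE')).
by congr (_, _); apply: val_inj.
Qed.

Lemma remainder_unique (t t' : int) (i i' : nat) : i < k -> i' < k ->
  (i%:Z + k%:Z * t = i'%:Z + k%:Z * t')%R -> t = t' /\ i = i'.
Proof.
by move=> ik ik' e; have [|||-> []] := @euclid_unique k t t' i i'; lia.
Qed.

Lemma free_cR : free_rel a cR.
Proof.
apply: eq_free_rel (fsym cR_word) _; apply: free_rel_subst (free_rel_conjz ab_free) => //.
  by move=> ti; apply: is_reduced_square.
move=> [t i] [t' i'] x x' /=; rewrite !inE => /eqP -> /eqP -> /= e.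
have qk (i0 : 'I_q) : i0 < k by have := ltn_ord i0; rewrite /k; lia.
have [-> ii] := remainder_unique (qk i) (qk i') e.
by congr (_, _); apply: val_inj.
Qed.

(** * Generators of the intersection, and the three ranks *)

Definition index_cap := {j : 'I_p & 'I_(r j)}.

Definition gen_cap (x : index_cap) : G := cL (Posz (tagged x), tag x).

Let cP := conj_family a (k * l)%N gen_cap.

Definition word_cap (sx : int * index_cap) : seq (int * 'I_p * bool) :=
  [:: ((((tagged sx.2 : nat)%:Z + k%:Z * sx.1)%R, tag sx.2), false)].

Lemma cP_word : cP =1 fun sx => eval cL (word_cap sx).
Proof.
move=> [s x]; rewrite /cP /conj_family /gen_cap /= eval1 /cL /conj_family conjzD /=.
by congr conjz; rewrite PoszM GRing.mulrDr GRing.mulrA [(l%:Z * k%:Z)%R]GRing.mulrC.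
Qed.

(** Conjugation by the s-th power of a^(kl) turns generator [(j, i)] into the member of [cL] of
    index [(i + ks, j)]. As [i < k], these indices are distinct, so [cP] is a reindexed subfamily of
    [cL]. *)
Lemma free_cP : free_rel a cP.
Proof.
apply: eq_free_rel (fsym cP_word) _; apply: free_rel_subst free_cL => //.
  by move=> sx; apply: is_reduced_square.
move=> [s [j i]] [s' [j' i']] x x' /=; rewrite !inE => /eqP -> /eqP -> /= [+ jj].
subst j' => e.
have rk (i0 : 'I_(r j)) : i0 < k by have := ltn_ord i0; rewrite /k /r; lia.
have [-> ii] := remainder_unique (rk i) (rk i') e.
by congr (_, existT _ _ _); apply: val_inj.
Qed.

Definition left_subgroup := generated (adjoin_power a l gen_left).
Definition right_subgroup := generated (adjoin_power a k gen_right).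
Definition cap_subgroup := generated (adjoin_power a (k * l)%N gen_cap).

Lemma has_rank_left : has_rank left_subgroup p.+1.
Proof.
have := free_family_has_rank (free_adjoin_power _ free_cL).
by rewrite card_option card_ord; apply; rewrite /l; lia.
Qed.

Lemma has_rank_right : has_rank right_subgroup q.+1.
Proof.
have := free_family_has_rank (free_adjoin_power _ free_cR).
by rewrite card_option card_ord; apply; rewrite /k; lia.
Qed.

Lemma has_rank_cap : has_rank cap_subgroup M.+1.
Proof.
have := free_family_has_rank (free_adjoin_power _ free_cP).
rewrite card_option card_tagged sumnE big_map big_enum /=.
under eq_bigr do rewrite card_ord.
rewrite sum_minn_chunks //; apply; rewrite /k /l; nia.
Qed.

(** * The candidate lies in both subgroups *)

Lemma cap_sub_left : (cap_subgroup `<=` left_subgroup)%classic.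
Proof.
move=> _ [w ->]; apply: subgroup_eval (generated_subgroup _) _ => -[[x|] e] _ /=.
  exact: generated_conj_family.
by rewrite -[a ^+ _]/(expz a (k * l)%N) PoszM GRing.mulrC; exact: generated_expz.
Qed.

Lemma right_letter (s : int) (i : nat) : i < q -> right_subgroup (B (i%:Z + k%:Z * s)%R).
Proof.
move=> iq; have := generated_conj_family a k gen_right (s, Ordinal iq).
by rewrite -/cR cR_word /word_right eval1.
Qed.

Lemma cap_sub_right : (cap_subgroup `<=` right_subgroup)%classic.
Proof.
move=> _ [w ->]; apply: subgroup_eval (generated_subgroup _) _ => -[[[j i]|] e] _ /=; last first.
  by rewrite -[a ^+ _]/(expz a (k * l)%N) PoszM; exact: generated_expz.
rewrite /gen_cap /= cL_word; apply: subgroup_eval (generated_subgroup _) _ => x /mem_block /= hx.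
have hi := ltn_ord i.
(* From [l = pk + 1], kj + li = i + k(j + pi). The residue is [i] or [i + d j], both below [q]
   because [i < r j]. *)
have [v [vq ->]] : exists v : nat, v < q /\ x.1 = (v%:Z + k%:Z * (j%:Z + p%:Z * i%:Z))%R.
  case: hx => ->; [exists i | exists (i + d j)]; rewrite /d /l /r in hi *; split; try lia; nia.
exact: right_letter.
Qed.

(** * The retraction, and the reverse inclusion *)

Definition retract (z : int) : G := if ((z %% k)%Z < q%:Z)%R then B z else 1.

Lemma retract_divE (s i : int) : (0 <= i < k%:Z)%R ->
  retract (k%:Z * s + i)%R = if (i < q%:Z)%R then B (k%:Z * s + i)%R else 1.
Proof. by move=> hi; rewrite /retract GRing.mulrC modzMDl modz_small. Qed.

Lemma eval_retract_right w :
  eval retract (subst_word word_right w) = eval B (subst_word word_right w).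
Proof.
rewrite !eval_subst; apply: eq_eval => -[s i]; rewrite /word_right !eval1 /=.
have hi := ltn_ord i; rewrite GRing.addrC retract_divE; last by rewrite /k; lia.
by rewrite ifT //; lia.
Qed.

Lemma eval_retract_left (s i : int) j : (0 <= i < k%:Z)%R ->
  eval retract (word_left ((k%:Z * s + i)%R, j)) =
  if (i < (r j)%:Z)%R then cL ((k%:Z * s + i)%R, j) else 1.
Proof.
move=> ik; rewrite cL_word /word_left /=.
have dj : d j = q - r j by [].
have rq : r j <= q by rewrite /r; lia.
(* As [l] is 1 modulo [k], the first letter of the block has residue [i]. *)
have -> : ((k * j)%N%:Z + l%:Z * (k%:Z * s + i))%R =
    (k%:Z * (j%:Z + p%:Z * (k%:Z * s + i) + s) + i)%R by rewrite /l; lia.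
set c := (_ + s)%R; rewrite /block dj; have [d0|d0] := eqVneq (q - r j) 0.
  by rewrite !eval1 /= retract_divE //; have -> : r j = q by lia.
rewrite !eval_cons !eval_nil /= -GRing.addrA /letter_val /= retract_divE //.
have [ir|ir] := boolP (i < (r j)%:Z)%R.
  rewrite retract_divE; last by rewrite /k; lia.
  by rewrite !ifT //; lia.
(* If [i >= q], the first letter dies and the second, whatever its image, cancels with its
   inverse. *)
case: ifP => iq; last by rewrite mul1g invg1 mul1g mulg1 mulgV.
(* Now [r j <= i < q], so [q <= i + d j < k]: the second letter dies and the commutator
   collapses. *)
rewrite retract_divE; last by rewrite /k; lia.
by rewrite ifF ?invg1 ?mulg1 ?mul1g ?mulgV //; lia.
Qed.

Lemma sub_cap : (left_subgroup `&` right_subgroup `<=` cap_subgroup)%classic.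
Proof.
move=> g [/generated_adjoin_power[w [t gL]] /generated_adjoin_power[w' [t' gR]]].
have eL : eval cL w = eval B (subst_word word_left w).
  by rewrite eval_subst; exact: eq_eval cL_word _.
have eR : eval cR w' = eval B (subst_word word_right w').
  by rewrite eval_subst; exact: eq_eval cR_word _.
move: gL gR; rewrite -/cL -/cR eL eR => gL gR.
have [tt' ww'] := free_rel_eq (free_rel_conjz ab_free) (etrans (esym gL) gR).
(* The retraction fixes the right-hand word, hence also the left-hand word, which has the same value
   under every map. *)
have -> : g = eval (fun tj => eval retract (word_left tj)) w * expz a (l%:Z * t)%R.
  by rewrite -eval_subst ww' eval_retract_right -ww' -gL.
have hP : is_subgroup cap_subgroup by exact: generated_subgroup.
apply: subgroupM => //.
  apply: subgroup_eval => // -[[t1 j] e] _ /=; have k0 := k_gt0.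
  rewrite (divz_eq t1 k) GRing.mulrC eval_retract_left; last first.
    by rewrite modz_ge0 ?ltz_pmod //; lia.
  set i := (t1 %% k)%Z; set s := (t1 %/ k)%Z.
  have i0 : (0 <= i)%R by apply: modz_ge0; lia.
  case: ifP => ir; last by case/is_subgroupP: hP.
  case: i i0 ir => // i _ ir; have {}ir : i < r j by lia.
  have := generated_conj_family a (k * l)%N gen_cap (s, existT _ j (Ordinal ir)).
  by rewrite -/cP cP_word eval1 /= GRing.addrC.
have -> : (l%:Z * t = (k * l)%N%:Z * (t' - p%:Z * t))%R.
  (* From lt = kt' and [l = pk + 1], [k] divides [t], with this explicit quotient. *)
  have te : t = (k%:Z * (t' - p%:Z * t))%R by move: tt'; rewrite /l; lia.
  by rewrite {1}te; lia.
exact: generated_expz.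
Qed.

End Construction.

Theorem mainTheorem2 (F : groupType) (hF : is_free_group F)
    (hnab : ~ (forall x y : F, commute x y))
    (m n N : nat) (hm : 2 <= m) (hn : 2 <= n)
    (hN : 1 <= N - 1 <= (m - 1) * (n - 1)) :
  exists H K : set F,
    is_subgroup H /\ is_subgroup K /\
    has_rank H m /\ has_rank K n /\
    has_rank (H `&` K)%classic N.
Proof.
have [a [b ab]] := free_group_free_pair hF hnab.
have q_gt0 : 0 < n - 1 by lia.
have M_le : N - 1 <= (m - 1) * (n - 1) by case/andP: hN.
exists (left_subgroup a b (m - 1) (n - 1) (N - 1)), (right_subgroup a b (n - 1)).
split; first exact: generated_subgroup.
split; first exact: generated_subgroup.
split; first by have := has_rank_left ab q_gt0 M_le; rewrite subn1 prednK //; lia.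
split; first by have := has_rank_right ab q_gt0 M_le; rewrite subn1 prednK //; lia.
have -> : (left_subgroup a b (m - 1) (n - 1) (N - 1) `&` right_subgroup a b (n - 1) =
    cap_subgroup a b (m - 1) (n - 1) (N - 1))%classic.
  apply/seteqP; split; first exact: sub_cap ab q_gt0 M_le.
  by move=> g gP; split; [exact: cap_sub_left gP|exact: cap_sub_right gP].
by have := has_rank_cap ab q_gt0 M_le; have -> : (N - 1).+1 = N by lia.
Qed.
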